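(* Let $p$ be a prime and let $H$ be a finite $p'$-group of central type. Suppose that $H/\mathrm{Z}(H)$ acts faithfully on a finite elementary abelian $p$-group $V$ such that $|H:H_v|>|H_v:\mathrm{Z}(H)|$ for all $v\in V\setminus\{1\}$. Then $G:=V\rtimes H$ has a $p$-block $B$ such that $\mathrm{IBr}(B)=\{\varphi\}$ and $\varphi$ has a unique lift to $\mathrm{Irr}(B)$.
   Context: A finite group $H$ with center $\mathrm{Z}(H)$ is of central type if there exists $\chi\in\mathrm{Irr}(H)$ with $\chi(1)^2=|H:\mathrm{Z}(H)|$; equivalently, there exists $\lambda\in\mathrm{Irr}(\mathrm{Z}(H))$ such that $\lambda^H=e\chi$ for some integer $e$ and some $\chi\in\mathrm{Irr}(H)$. The group $H$ acts on $V$ via the quotient $H/\mathrm{Z}(H)$, and $H_v$ denotes the stabilizer of $v\in V$ in $H$. For a $p$-block $B$ of $G$, $\mathrm{Irr}(B)$ and $\mathrm{IBr}(B)$ denote the sets of irreducible ordinary characters and irreducible $p$-Brauer characters belonging to $B$. A lift of $\varphi\in\mathrm{IBr}(B)$ is a character $\chi\in\mathrm{Irr}(B)$ whose restriction to the set of $p$-regular elements of $G$ equals $\varphi$. *)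

(* Defs.v *)
From HB Require Import structures.
From mathcomp Require Import all_boot all_order all_algebra all_fingroup.
From mathcomp Require Import all_solvable all_field all_character.

Set Implicit Arguments.
Unset Strict Implicit.
Unset Printing Implicit Defensive.

Import Order.TTheory GroupScope GRing.Theory Num.Theory.
Local Open Scope ring_scope.

Definition central_type (gT : finGroupType) (H : {group gT}) : Prop :=
  exists i : Iirr H, 'chi_i 1%g ^+ 2 = #|H : 'Z(H)|%:R.

(* Reduction modulo a maximal ideal M, containing p, of the ring Aint of       *)
(* algebraic integers: F is Aint / M and red is the quotient map. Since red is *)
(* onto a field, its kernel M on Aint is maximal. The values of red outside of *)
(* Aint are irrelevant.                                                        *)
Record modular_reduction (p : nat) (F : fieldType) (red : algC -> F) : Prop :=
  ModularReduction {
    red_pchar : p \in [pchar F];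
    red1 : red 1 = 1;
    redD : {in Aint &, {morph red : x y / x + y}};
    redM : {in Aint &, {morph red : x y / x * y}};
    red_surj : forall y : F, exists2 x, x \in Aint & red x = y
  }.

Definition pprime_unity_root (p : nat) (z : algC) : Prop :=
  exists2 m : nat, ~~ (p %| m)%N & z ^+ m = 1.

Section ModularCharacters.

Variables (p : nat) (F : fieldType) (red : algC -> F).
Variables (gT : finGroupType) (G : {group gT}).

Definition p_regular : {set gT} := [set x in G | p^'.-elt x].

(* A Brauer character is only defined on p-regular elements; it is extended by *)
(* 0 so as to be a class function on G. For x p-regular, s lists the lifts to  *)
(* p'-roots of unity of the eigenvalues of rG x, with multiplicity.            *)
Definition affords_Brauer_char (n : nat) (rG : mx_representation F G n)
    (phi : 'CF(G)) : Prop :=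
  phi \in 'CF(G, p_regular) /\
  forall x, x \in p_regular -> exists s : seq algC,
    [/\ forall z, z \in s -> pprime_unity_root p z,
        char_poly (rG x) = \prod_(z <- s) ('X - (red z)%:P)
      & phi x = \sum_(z <- s) z].

(* Central characters Z(FG) -> F are given by their values on the class sums   *)
(* gset_mx F G K, for K a conjugacy class of G.                                *)
Definition irr_affords_central_char (i : Iirr G) (lam : {set gT} -> F) : Prop :=
  forall K, K \in classes G -> lam K = red 'omega_i[gset_mx algC G K].

Definition repr_affords_central_char (n : nat) (rG : mx_representation F G n)
    (lam : {set gT} -> F) : Prop :=
  forall K, K \in classes G -> gring_op rG (gset_mx F G K) = (lam K)%:M.

Definition IBr_central_char (phi : 'CF(G)) (lam : {set gT} -> F) : Prop :=
  exists (n : nat) (rG : mx_representation F G n),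
    [/\ mx_irreducible rG, affords_Brauer_char rG phi
      & repr_affords_central_char rG lam].

(* The p-blocks are the classes of the relation of having the same central     *)
(* character on the union of Irr(G) and IBr(G); the block B is represented by  *)
(* the common central character of its members.                                *)
Record p_block : Type := PBlock {
  block_char : {set gT} -> F;
  block_charP : (exists i : Iirr G, irr_affords_central_char i block_char) \/
                (exists phi : 'CF(G), IBr_central_char phi block_char)
}.

Definition in_Irr_block (B : p_block) (i : Iirr G) : Prop :=
  irr_affords_central_char i (block_char B).

Definition in_IBr_block (B : p_block) (phi : 'CF(G)) : Prop :=
  IBr_central_char phi (block_char B).

Definition is_lift (B : p_block) (phi : 'CF(G)) (i : Iirr G) : Prop :=
  in_Irr_block B i /\ {in p_regular, 'chi_i =1 phi}.

End ModularCharacters.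

(* Main.v *)
(* Let chi be the character of H with chi(1)^2 = |H : Z(H)|; it vanishes off  *)
(* Z(H) and is chi(1) * lam on Z(H), so every h in H outside Z(H) has a       *)
(* commutator [h, g] in Z(H) with lam [h, g] != 1. The block B is that of the *)
(* inflation psi of chi to G = V H.                                           *)
(*   Let W be an irreducible F-representation of G in B. Then V acts          *)
(* trivially on W (it is a normal p-subgroup) and Z(H) acts through red o     *)
(* lam, and such W exist inside the regular representation. If h is not in    *)
(* Z(H), then W(h) is conjugate to red(c) W(h) for some root of unity c != 1: *)
(* hence its spectrum is invariant under multiplication by c, and the Brauer  *)
(* character of W vanishes at h. The W(t), for t in a transversal of Z(H) in  *)
(* H, thus form a basis of the matrix algebra, so W has degree chi(1), and    *)
(* its Brauer character is psi on p-regular elements.                         *)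
(*   A lift of this Brauer character restricts to chi on H, so it is psi as   *)
(* soon as V is in its kernel. Otherwise it lies over some nontrivial mu in   *)
(* Irr(V), whence |H : H_mu| <= chi(1) by Clifford's theorem. By coprime      *)
(* action H_mu fixes some v != 1 in V, so that |H : Z(H)| = |H : H_v| |H_v :  *)
(* Z(H)| < |H : H_v|^2 <= chi(1)^2 = |H : Z(H)|.                              *)

Require Import Defs.
From HB Require Import structures.
From mathcomp Require Import all_boot all_order all_algebra all_fingroup.
From mathcomp Require Import all_solvable all_field all_character.

Set Implicit Arguments.
Unset Strict Implicit.
Unset Printing Implicit Defensive.

Import Order.TTheory GroupScope GRing.Theory Num.Theory.
Local Open Scope ring_scope.

(** The proof turns on [central_type_commg]: each h in H outside Z(H) has a conjugate h * z with z
    in Z(H) and lam z != 1. In an irreducible F-module W of G on which Z(H) acts through red o lam,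
    this kills the trace of h ([repr_trace0]), so W has degree chi(1) ([repr_degree]) and its Brauer
    character is the inflation of chi, whatever W is ([Brauer_lift_sum]). Such a W exists
    ([irr_repr_exists]), and these W are exactly the irreducible modules with the central character
    of the inflation ([repr_central_charE], [IBr_central_char_inflation]); hence the block has a
    single Brauer character. Uniqueness of the lift is a degree count ([sub_cfker_lift]), in which
    [coprime_fixed_lin_char] transfers the hypothesis on stabilizers from V to Irr(V). Two facts on
    [red] support this: it is injective on roots of unity of order prime to p
    ([red_unity_root_inj]), and F is algebraically closed ([red_closed_field]). *)

Lemma root_monic_polyOver_Aint (q : {poly algC}) x :
  root q x -> q \is monic -> q \is a polyOver Aint -> x \in Aint.
Proof.
move=> qx0 mon_q /polyOverP Aq.
pose intC : {rmorphism int -> algC} := intr.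
(* [minCpoly] has integer coefficients on [Aint], so [Aint] is the set of elements integral over
   [int], and transitivity of integrality applies. *)
have intCP y : integralOver intC y <-> y \in Aint.
  split=> [[r mon_r ry0] | Ay].
    apply: root_monic_Aint ry0 _ _; first exact: monic_map.
    by apply/polyOverP=> i; rewrite coef_map /= rpred_int_num.
  have /floorpP[r Dr] : minCpoly y \is a polyOver Num.int by [].
  exists r; last by rewrite -Dr root_minCpoly.
  rewrite monicE -(inj_eq (@intr_inj algC)) -(lead_coef_map_inj (@intr_inj
    algC)) //.
  by rewrite -Dr (monicP (minCpoly_monic y)).
apply/intCP; apply: integral_root_monic mon_q qx0 _.
by apply/integral_poly => i; apply/intCP/Aq.
Qed.

(** * Reduction of algebraic integers and of roots of unity *)

Section ModularReduction.

Variables (p : nat) (F : fieldType) (red : algC -> F).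
Hypothesis redP : modular_reduction p red.

Lemma red0 : red 0 = 0.
Proof.
by apply: (addrI (red 0)); rewrite -(redD redP) ?rpred0 // !addr0.
Qed.

Lemma redX (x : algC) n : x \in Aint -> red (x ^+ n) = red x ^+ n.
Proof.
move=> Ax; elim: n => [|n IHn]; first by rewrite !expr0 (red1 redP).
by rewrite !exprS (redM redP) ?rpredX // IHn.
Qed.

Lemma red_sum (I : Type) (r : seq I) (P : pred I) (E : I -> algC) :
  (forall i, P i -> E i \in Aint) ->
  red (\sum_(i <- r | P i) E i) = \sum_(i <- r | P i) red (E i).
Proof.
(* [red] is additive only on [Aint], so membership is carried along with the value. *)
move=> AE; pose K (x : algC) (y : F) := x \in Aint /\ red x = y.
suffices: K (\sum_(i <- r | P i) E i) (\sum_(i <- r | P i) red (E i)) by case.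
apply: (big_ind2 K) => [|x1 x2 y1 y2 [Ax <-] [Ay <-]|i Pi].
- by split; [apply: rpred0 | apply: red0].
- by split; [apply: rpredD | rewrite (redD redP)].
- by split; [apply: AE|].
Qed.

Lemma red_prod (I : Type) (r : seq I) (P : pred I) (E : I -> algC) :
  (forall i, P i -> E i \in Aint) ->
  red (\prod_(i <- r | P i) E i) = \prod_(i <- r | P i) red (E i).
Proof.
move=> AE; pose K (x : algC) (y : F) := x \in Aint /\ red x = y.
suffices: K (\prod_(i <- r | P i) E i) (\prod_(i <- r | P i) red (E i)) by case.
apply: (big_ind2 K) => [|x1 x2 y1 y2 [Ax <-] [Ay <-]|i Pi].
- by split; [apply: rpred1 | apply: (red1 redP)].
- by split; [apply: rpredM | rewrite (redM redP)].
- by split; [apply: AE|].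
Qed.

Lemma redN (x : algC) : x \in Aint -> red (- x) = - red x.
Proof.
move=> Ax; apply: (addrI (red x)).
by rewrite -(redD redP) ?rpredN // !subrr red0.
Qed.

Lemma red_nat n : red n%:R = n%:R.
Proof.
elim: n => [|n IHn]; first exact: red0.
by rewrite -!natr1 (redD redP) ?rpred1 ?rpred_nat // IHn (red1 redP).
Qed.

Lemma pprime_unity_root_Aint z : pprime_unity_root p z -> z \in Aint.
Proof.
case=> m pm zm1; apply: (@Aint_unity_root m).
  by case: m pm {zm1} => //; rewrite dvdn0.
exact/unity_rootP.
Qed.

Lemma pprime_unity_root_neq0 z : pprime_unity_root p z -> z != 0.
Proof.
case=> m pm zm1; apply: contra_eqN zm1 => /eqP->.
by case: m pm => [|m _]; rewrite ?dvdn0 // expr0n eq_sym oner_neq0.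
Qed.

Lemma pprime_unity_rootM y z : prime p ->
  pprime_unity_root p y -> pprime_unity_root p z -> pprime_unity_root p (y * z).
Proof.
move=> pr_p [m pm ym1] [n pn zn1]; exists (m * n)%N.
  by rewrite Euclid_dvdM // negb_or pm.
by rewrite exprMn exprM ym1 mulnC exprM zn1 !expr1n mul1r.
Qed.

(** If z != 1, the sum of the z ^+ i for i < m vanishes, while it reduces to m when red z = 1; then
    p divides m. *)
Lemma red_unity_root_eq1 z : pprime_unity_root p z -> red z = 1 -> z = 1.
Proof.
move=> [m pm zm1] redz1; have Az : z \in Aint.
  by apply: pprime_unity_root_Aint; exists m.
apply/eqP; apply: contraNT pm; rewrite -subr_eq0 => nz_z1.
have: \sum_(i < m) z ^+ i = 0.
  by apply: (mulfI nz_z1); rewrite -subrX1 zm1 subrr mulr0.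
move/(congr1 red); rewrite red_sum => [|i _]; last exact: rpredX.
rewrite red0 (eq_bigr (fun=> 1)) => [|i _]; last by rewrite redX ?redz1 ?expr1n.
by rewrite sumr_const card_ord (dvdn_pcharf (red_pchar redP)) => ->.
Qed.

Lemma red_unity_root_inj y z : prime p ->
  pprime_unity_root p y -> pprime_unity_root p z -> red y = red z -> y = z.
Proof.
move=> pr_p uy uz eq_yz; have [Ay Az] := (pprime_unity_root_Aint uy,
  pprime_unity_root_Aint uz).
have [m pm zm1] := uz.
have uzV : pprime_unity_root p z^-1 by exists m; rewrite // exprVn zm1 invr1.
have AzV := pprime_unity_root_Aint uzV.
have: y * z^-1 = 1.
  apply: red_unity_root_eq1; first exact: pprime_unity_rootM.
  by rewrite (redM redP) // eq_yz -(redM redP) // divff ?pprime_unity_root_neq0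
    ?(red1 redP).
by move/(canRL (mulfVK (pprime_unity_root_neq0 uz))); rewrite mul1r.
Qed.

(** Lift y to x in [Aint]: the product of the x - w ^+ i, for w a primitive m-th root of unity,
    reduces to y ^+ m - 1 = 0, so some factor reduces to 0. *)
Lemma lift_unity_root m (y : F) : ~~ (p %| m)%N -> y ^+ m = 1 ->
  exists2 z, pprime_unity_root p z & red z = y.
Proof.
move=> pm ym1; have m_gt0 : (0 < m)%N by case: m pm {ym1}; rewrite ?dvdn0.
have [w prim_w] := C_prim_root_exists m_gt0.
have Aw i : w ^+ i \in Aint.
  apply: rpredX; apply: (Aint_unity_root m_gt0);
    exact/unity_rootP/prim_expr_order.
have [x Ax red_x] := red_surj redP y.
have: red (x ^+ m - 1) = 0.
  by rewrite (redD redP) ?rpredN ?rpredX ?rpred1 // redN ?rpred1 // redX //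
    red_x ym1 (red1 redP) subrr.
have -> : x ^+ m - 1 = \prod_(0 <= i < m) (x - w ^+ i).
  have := congr1 (fun q => q.[x]) (factor_Xn_sub_1 prim_w).
  by rewrite horner_prod !hornerE => <-; apply: eq_bigr => i _; rewrite
    !hornerE.
rewrite red_prod => [|i _]; last by rewrite rpredB.
move/eqP; rewrite prodf_seq_eq0 => /hasP[i _].
rewrite (redD redP) ?rpredN // redN // red_x subr_eq0 => /eqP eq_y.
exists (w ^+ i) => //; exists m => //.
by rewrite -exprM mulnC exprM (prim_expr_order prim_w) expr1n.
Qed.

Lemma lift_unity_roots m (t : seq F) : ~~ (p %| m)%N ->
  (forall y, y \in t -> y ^+ m = 1) ->
  exists2 s, (forall z, z \in s -> pprime_unity_root p z) & map red s = t.
Proof.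
move=> pm; elim: t => [|y t IHt] t1; first by exists nil.
have [|s us eq_t] := IHt; first by move=> z tz; apply: t1; rewrite inE tz orbT.
have [z uz eq_y] := lift_unity_root pm (t1 _ (mem_head y t)).
exists (z :: s) => [x|]; last by rewrite /= eq_y eq_t.
by rewrite inE => /predU1P[-> | /us].
Qed.

(** This makes the value of a Brauer character depend only on the eigenvalues in F. *)
Lemma perm_unity_roots (s t : seq algC) : prime p ->
    (forall z, z \in s -> pprime_unity_root p z) ->
    (forall z, z \in t -> pprime_unity_root p z) ->
  perm_eq (map red s) (map red t) -> perm_eq s t.
Proof.
move=> pr_p us ut.
(* A left inverse of [red] on s ++ t: the first entry that reduces to y. *)
pose f y := nth 0 (s ++ t) (find (fun z => red z == y) (s ++ t)).
have fK z : z \in s ++ t -> f (red z) = z.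
  have ust x : x \in s ++ t -> pprime_unity_root p x.
    by rewrite mem_cat => /orP[/us | /ut].
  move=> st_z; have has_z : has (fun x => red x == red z) (s ++ t).
    by apply/hasP; exists z.
  have st_fz : f (red z) \in s ++ t by rewrite mem_nth -?has_find.
  apply: red_unity_root_inj (ust _ st_fz) (ust _ st_z) _ => //.
  by have /= /eqP := nth_find 0 has_z.
move/(perm_map f); rewrite -!map_comp !map_id_in // => z z_st;
  by apply: fK; rewrite mem_cat z_st ?orbT.
Qed.

(** Lift the coefficients of a monic equation to [Aint]; a root in algC is integral, and its
    reduction solves the given equation. *)
Lemma red_closed_field : GRing.closed_field_axiom F.
Proof.
move=> n P n_gt0.
have /fin_all_exists[Q redQ] (i : 'I_n) : exists x, x \in Aint /\ red x = P i.
  by have [x Ax eq_x] := red_surj redP (P i); exists x.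
pose Q' i := if insub i is Some j then Q j else 0.
have Q'E (i : 'I_n) : Q' i = Q i by rewrite /Q' valK.
have [x Dx] := solve_monicpoly Q' n_gt0.
have Ax : x \in Aint.
  pose q : {poly algC} := 'X^n - \poly_(i < n) Q' i.
  have szq : (size (- (\poly_(i < n) Q' i)) < size ('X^n : {poly algC}))%N.
    by rewrite size_polyN size_polyXn ltnS size_poly.
  apply: (@root_monic_polyOver_Aint q).
  - by rewrite /root /q hornerD hornerN hornerXn horner_poly subr_eq0 Dx.
  - by rewrite /q monicE lead_coefDl // lead_coefXn.
  - rewrite /q rpredB ?rpredX ?polyOverX //; apply/polyOver_poly => i lt_in.
    by rewrite (Q'E (Ordinal lt_in)); case: (redQ (Ordinal lt_in)).
exists (red x); rewrite -redX // Dx red_sum => [|i _].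
  by apply: eq_bigr => i _; rewrite Q'E; case: (redQ i) => AQ <-; rewrite (redM
    redP) ?rpredX ?redX.
by rewrite Q'E rpredM ?rpredX //; case: (redQ i).
Qed.

End ModularReduction.

(** * Closed field structure, and characteristic polynomials *)

Lemma closedFieldType_exists (F : fieldType) : GRing.closed_field_axiom F ->
  exists Fc : closedFieldType, Fc = F :> fieldType.
Proof.
(* [F] is destructed so that the packed closed field projects back to it by conversion. *)
case: F => T [? ? ? ? ? ? ? ? ? ? ? ? ? ? ?]; set F := GRing.Field.Pack _ => ax.
pose Fc : closedFieldType :=
  HB.pack (GRing.Field.sort F) (Field_isAlgClosed.Build F ax).
by exists Fc.
Qed.

Lemma char_poly_scale (F : fieldType) n (A : 'M[F]_n) (c : F) (t : seq F) :
  c != 0 -> char_poly A = \prod_(y <- t) ('X - y%:P) ->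
  char_poly (c *: A) = \prod_(y <- t) ('X - (c * y)%:P).
Proof.
move=> nz_c DA.
have szt : size t = n.
  by apply: succn_inj; rewrite -(size_prod_XsubC t id) -DA size_char_poly.
pose q : {poly F} := c^-1 *: 'X.
(* det (X - c A) = c^n det (c^-1 X - A). *)
have -> : char_poly (c *: A) = c ^+ n *: (char_poly A \Po q).
  rewrite /char_poly -det_map_mx -mul_polyC polyC_exp -detZ; congr (\det _).
  apply/matrixP=> i j; rewrite !mxE raddfB raddfMn /= comp_polyX comp_polyC
    mulrBr.
  by rewrite polyCM mulrnAr (mul_polyC c q) scalerA mulfV // scale1r.
rewrite DA rmorph_prod /= -szt -mul_polyC polyC_exp.
have -> : c%:P ^+ size t = \prod_(y <- t) c%:P.
  by rewrite big_const_seq count_predT iter_mulr_1.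
rewrite -big_split /=.
apply: eq_bigr => y _; rewrite raddfB /= comp_polyX comp_polyC mulrBr
  (mul_polyC c q).
by rewrite scalerA mulfV // scale1r polyCM.
Qed.

Lemma char_poly_conj (R : comNzRingType) n (A P Q : 'M[R]_n) : Q *m P = 1%:M ->
  char_poly (Q *m A *m P) = char_poly A.
Proof.
move=> QP1; pose f := map_mx (@polyC R) : 'M[R]_n -> 'M[{poly R}]_n.
have fQP : f Q *m f P = 1%:M by rewrite -map_mxM QP1 map_mx1.
have -> : char_poly (Q *m A *m P) = \det (f Q *m char_poly_mx A *m f P).
  rewrite mulmxBr mulmxBl scalar_mxC -[_%:M *m _ *m _]mulmxA fQP mulmx1
    /char_poly /char_poly_mx.
  by rewrite !map_mxM.
by rewrite !det_mulmx mulrAC -det_mulmx fQP det1 mul1r.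
Qed.

(** * Characters of groups of central type *)

Section CentralType.

Variables (gT : finGroupType) (H : {group gT}).

(** By Schur's lemma the sum of the rG (b ^ x) is scalar; its trace determines the scalar, and the
    trace of its product with rG a is the sum on the left. *)
Lemma irr_conj_sum (i : Iirr H) (a b : gT) : a \in H -> b \in H ->
  'chi_i 1%g * \sum_(x in H) 'chi_i (a * b ^ x)%g
    = #|H|%:R * ('chi_i a * 'chi_i b).
Proof.
move=> Ha Hb.
have [n [rG [irrG <-]]] : exists n (rG : mx_representation algCfield H n),
    mx_irreducible rG /\ cfRepr rG = 'chi_i.
  by exists _, 'Chi_i; split; [apply: socle_irr | apply: irrRepr].
have trE x : x \in H -> cfRepr rG x = \tr (rG x) by move=> Hx; rewrite cfunE Hx.
pose S := \sum_(x in H) rG (b ^ x)%g.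
have /is_scalar_mxP[c DS]: is_scalar_mx S.
  apply: mx_abs_irr_cent_scalar; first exact: (groupC irrG).
  apply/centgmxP=> y Hy; rewrite mulmx_suml mulmx_sumr.
  rewrite [RHS](reindex_acts 'R _ Hy) ?astabsR //=; apply: eq_bigr => x Hx.
  by rewrite -!repr_mxM ?groupJ ?groupM // conjgM conjgC.
have Db : #|H|%:R * cfRepr rG b = c * cfRepr rG 1%g.
  rewrite (trE _ (group1 H)) repr_mx1 -mxtraceZ scalemx1 -DS raddf_sum /=.
  rewrite mulr_natl -sumr_const; apply: eq_bigr => x Hx.
  by rewrite -trE ?groupJ // cfunJ.
rewrite mulrCA Db mulrA [RHS]mulrC. congr (_ * _).
rewrite [RHS]mulrC (trE a) // -mxtraceZ -mul_mx_scalar -DS mulmx_sumr raddf_sum.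
apply: eq_bigr => x Hx; have Hbx : (b ^ x)%g \in H by rewrite groupJ.
by rewrite /= (trE _ (groupM Ha Hbx)) repr_mxM.
Qed.

Variable i : Iirr H.
Hypothesis chi1 : 'chi_i 1%g ^+ 2 = #|H : 'Z(H)|%:R.

(** chi(1)^2 is at most |H : Z(chi)|, and Z(H) lies in Z(chi); central type forces equality. The
    equality case of the same bound yields the vanishing of chi off Z(H). *)
Lemma central_type_cfcenter : 'Z('chi_i)%CF = 'Z(H).
Proof.
have sZ : 'Z(H) \subset 'Z('chi_i)%CF by rewrite -cap_cfcenter_irr bigcap_inf.
have [/= le_chi _] := irr1_bound i.
apply/esym/eqP; rewrite eqEcard sZ /=.
have sZchi : 'Z('chi_i)%CF \subset H by apply: cfcenter_sub.
rewrite chi1 ler_nat in le_chi.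
rewrite -(leq_pmul2r (indexg_gt0 H 'Z(H))) (Lagrange (center_sub H)).
by rewrite -(Lagrange sZchi) leq_pmul2l.
Qed.

Lemma central_type_vanish h : h \notin 'Z(H) -> 'chi_i h = 0.
Proof.
have [_ eq_chi] := irr1_bound i.
move: eq_chi; rewrite central_type_cfcenter chi1 eqxx => /esym chiZ.
by move=> notZ; apply: cfun_on0 chiZ notZ.
Qed.

Lemma central_type_lin_char : exists2 lam : 'CF('Z(H)), lam \is a linear_char
  & {in 'Z(H), forall z, 'chi_i z = 'chi_i 1%g * lam z}.
Proof.
have := cfcenter_Res 'chi_i; rewrite central_type_cfcenter => -[lam Llam Dlam].
exists lam => // z Zz; have:= congr1 (fun f : 'CF('Z(H)) => f z) Dlam.
by rewrite cfResE ?center_sub // cfunE.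
Qed.

(** Apply [irr_conj_sum] to h^-1 and h: as chi h = 0, the sum of the chi [~ h, x] is 0. Without such
    a g every term would be 0 or chi(1), and the term at x = 1 is chi(1) > 0. *)
Lemma central_type_commg (lam : 'CF('Z(H))) h :
    {in 'Z(H), forall z, 'chi_i z = 'chi_i 1%g * lam z} ->
    h \in H -> h \notin 'Z(H) ->
  exists2 g, g \in H & [~ h, g] \in 'Z(H) /\ lam [~ h, g] != 1.
Proof.
move=> chiE Hh notZh.
have [g /and3P[Hg Zg lam_g]|noG] :=
  pickP [pred g in H | ([~ h, g] \in 'Z(H)) && (lam [~ h, g] != 1)].
  by exists g.
have d_gt0 := irr1_gt0 i.
have /eqP := irr_conj_sum i (groupVr Hh) Hh.
rewrite (central_type_vanish notZh) !mulr0 mulf_eq0 gt_eqF //= psumr_eq0.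
  move/allP/(_ 1%g); rewrite mem_index_enum group1 conjg1 mulVg gt_eqF //.
  by move/(_ isT).
move=> g Hg; rewrite -/[~ h, g]; have [Zg | /central_type_vanish-> //] := boolP
  ([~ h, g] \in 'Z(H)).
rewrite chiE //; have := noG g; rewrite /= Hg Zg /= => /negbFE/eqP->.
by rewrite mulr1 ltW.
Qed.

End CentralType.

(** * Irreducible modules in the block of the inflated character *)

Section Block.

Variables (p : nat) (F : closedFieldType) (red : algC -> F).
Hypotheses (pr_p : prime p) (redP : modular_reduction p red).

Variables (gT : finGroupType) (G V H : {group gT}).
Hypotheses (defG : V ><| H = G) (pV : p.-group V) (p'H : p^'.-group H).
Hypothesis cVZ : 'Z(H) \subset 'C(V).

Variables (i : Iirr H) (lam : 'CF('Z(H))).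
Hypothesis chi1 : 'chi_i 1%g ^+ 2 = #|H : 'Z(H)|%:R.
Hypothesis lam_lin : lam \is a linear_char.
Hypothesis chiE : {in 'Z(H), forall z, 'chi_i z = 'chi_i 1%g * lam z}.

Let sVG : V \subset G. Proof. by case/sdprod_context: defG => /andP[]. Qed.
Let sHG : H \subset G. Proof. by case/sdprod_context: defG. Qed.
Let sZH := center_sub H.
Let sZG : 'Z(H) \subset G := subset_trans sZH sHG.

Let sZGcenter : 'Z(H) \subset 'Z(G).
Proof.
rewrite subsetI sZG /= -(sdprodW defG) centM subsetI cVZ.
by rewrite subIset ?subxx ?orbT.
Qed.

Lemma p'group_ndvdn m : (m %| #|H|)%N -> ~~ (p %| m)%N.
Proof.
by move=> mH; rewrite -p'natE //; apply: pnat_dvd mH p'H.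
Qed.

Lemma central_lin_char_unity_root z : z \in 'Z(H) -> pprime_unity_root p (lam
  z).
Proof.
move=> Zz; exists #|H|; first exact: p'group_ndvdn.
by rewrite -lin_charX // (expg_cardG (subsetP sZH z Zz)) lin_char1.
Qed.

Section Representation.

Variables (n : nat) (rG : mx_representation F G n).
Hypothesis irrG : mx_irreducible rG.
Hypothesis rGZ : {in 'Z(H), forall z, rG z = (red (lam z))%:M}.

Let n_gt0 : (0 < n)%N. Proof. by case/mx_irrP: irrG. Qed.

Lemma repr_sdprodE v h : v \in V -> h \in H -> rG (v * h)%g = rG h.
Proof.
move=> Vv Hh; rewrite repr_mxM ?(subsetP sVG v) ?(subsetP sHG h) //.
have sVker : V \subset rker rG.
  apply: subset_trans (pcore_sub_rker_mx_irr_pchar (red_pchar redP) irrG).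
  by apply: pcore_max => //; case/sdprod_context: defG.
by have /rkerP[_ ->] := subsetP sVker v Vv; rewrite mul1mx.
Qed.

Lemma repr_conj_scale h : h \in H -> h \notin 'Z(H) ->
  exists c : algC, exists2 g, g \in H &
   [/\ pprime_unity_root p c, c != 1 & rG (h ^ g)%g = red c *: rG h].
Proof.
move=> Hh notZh; have [g Hg [Zc lam_c]] := central_type_commg chi1 chiE Hh
  notZh.
exists (lam [~ h, g]), g => //; split=> //; first exact:
  central_lin_char_unity_root.
rewrite -[(h ^ g)%g](mulKVg h) -/[~ h, g] repr_mxM ?(subsetP sHG h) ?(subsetP
  sZG) //.
by rewrite (rGZ Zc) mul_mx_scalar.
Qed.

Let repr_conj x g : x \in G -> g \in G -> rG (x ^ g)%g = rG g^-1%g *m rG x *m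
  rG g.
Proof. by move=> Gx Gg; rewrite /conjg !repr_mxM ?groupM ?groupV ?mulmxA. Qed.

(** Conjugation preserves the trace, but here multiplies it by red c, which is not 1 since c !=
    1. *)
Lemma repr_trace0 h : h \in H -> h \notin 'Z(H) -> \tr (rG h) = 0.
Proof.
move=> Hh /(repr_conj_scale Hh)[c [g Hg [uc c_neq1 Dhg]]].
have /eqP : \tr (rG (h ^ g)%g) = \tr (rG h).
  have [Gh Gg] := (subsetP sHG h Hh, subsetP sHG g Hg).
  by rewrite repr_conj // mxtrace_mulC mulmxA -repr_mxM ?groupV // mulgV
    repr_mx1 mul1mx.
rewrite Dhg mxtraceZ -subr_eq0 -{2}[\tr _]mul1r -mulrBl mulf_eq0 subr_eq0.
case/predU1P=> [red_c|/eqP//].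
by rewrite (red_unity_root_eq1 redP uc red_c) eqxx in c_neq1.
Qed.

Let splitG : group_splitting_field F G.
Proof. exact: group_closure_closed_field. Qed.

Let absG : mx_absolutely_irreducible rG := splitG irrG.

Let sdprodP x : x \in G ->
  exists v h, [/\ v \in V, h \in H & x = (v * h)%g].
Proof. by rewrite -(sdprodW defG) => /mulsgP[v h]; exists v, h. Qed.

(** If p divided n, scalar matrices would have trace 0, hence so would all rG x and their span. By
    absolute irreducibility this span is the whole matrix algebra, which contains a matrix unit of
    trace 1. *)
Lemma repr_degree_neq0 : n%:R != 0 :> F.
Proof.
have [_ [a_ a_G]] := mx_abs_irrP absG.
pose j := Ordinal n_gt0; apply: contraTneq (oner_neq0 F) => n0.
have <- : \tr (delta_mx j j : 'M[F]_n) = 1.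
  rewrite /mxtrace (bigD1 j) //= mxE !eqxx big1 ?addr0 // => k.
  by rewrite mxE => /negPf->.
apply/negPn/eqP.
rewrite [delta_mx j j]a_G raddf_sum big1 //= => x /sdprodP[v [h [Vv Hh ->]]].
rewrite mxtraceZ repr_sdprodE //.
have [Zh|/(repr_trace0 Hh)->] := boolP (h \in 'Z(H)); last by rewrite mulr0.
by rewrite rGZ // mxtrace_scalar -mulr_natr n0 !mulr0.
Qed.

(** The rG (t k), for t k representing the cosets of Z(H) in H, span the matrix algebra since V acts
    trivially and Z(H) by scalars. They are independent: after multiplication by rG (t j)^-1, the
    trace of a vanishing combination is n times its j-th coefficient. So n^2 = |H : Z(H)|. *)
Lemma repr_degree : n%:R = 'chi_i 1%g.
Proof.
suffices Dn : (n ^ 2 = #|H : 'Z(H)|)%N.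
  apply/eqP; rewrite -(eqrXn2 (n := 2)) ?ler0n ?ltW ?irr1_gt0 //.
  by rewrite chi1 -natrX Dn.
pose t (k : 'I_#|rcosets 'Z(H) H|) := repr (enum_val k).
have Ht k : t k \in H /\ enum_val k = 'Z(H) :* t k.
  have /rcosetsP[x Hx Dk] := enum_valP k; rewrite /t Dk; split.
    by have /rcosetP[z Zz ->] := mem_repr_rcoset 'Z(H) x; rewrite groupM
      ?(subsetP sZH z).
  by rewrite rcoset_repr.
pose M := \matrix_(k < #|rcosets 'Z(H) H|) mxvec (rG (t k)).
have fullM : row_full M.
  rewrite -sub1mx; have [_ ] := andP absG; rewrite -sub1mx => /submx_trans;
    apply.
  apply/row_subP=> j; rewrite rowK.
  have /sdprodP[v [h [Vv Hh ->]]] := enum_valP j; rewrite repr_sdprodE //.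
  have Zh : 'Z(H) :* h \in rcosets 'Z(H) H by apply/rcosetsP; exists h.
  pose k := enum_rank_in Zh ('Z(H) :* h).
  have [Htk Dk] := Ht k; rewrite enum_rankK_in // in Dk.
  have /rcosetP[z Zz ->]: h \in 'Z(H) :* t k by rewrite -Dk rcoset_refl.
  rewrite repr_mxM ?(subsetP sZG z) ?(subsetP sHG) // rGZ // mul_scalar_mx.
  by rewrite linearZ scalemx_sub // (eq_row_sub k) // rowK.
have freeM : row_free M.
  rewrite -kermx_eq0; apply/rowV0P=> u /sub_kermxP; rewrite mulmx_sum_row =>
    uM0.
  apply/rowP=> j; rewrite mxE; apply: (mulIf repr_degree_neq0); rewrite mul0r.
  have := congr1 (fun A => \tr (vec_mx A *m rG (t j)^-1%g)) uM0.
  have [Htj Dj] := Ht j; have Gtj := subsetP sHG _ Htj.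
  rewrite !linear0 mul0mx mxtrace0 linear_sum mulmx_suml raddf_sum (bigD1 j)
    //=.
  rewrite big1 => [|k neq_kj].
    rewrite addr0 rowK linearZ /= mxvecK -scalemxAl -repr_mxM ?groupV // mulgV.
    by rewrite repr_mx1 mxtraceZ mxtrace1.
  have [Htk Dk] := Ht k; have Gtk := subsetP sHG _ Htk.
  rewrite rowK linearZ /= mxvecK -scalemxAl -repr_mxM ?groupV // mxtraceZ.
  rewrite (repr_trace0 (groupM Htk (groupVr Htj))) ?mulr0 //; apply: contra
    neq_kj => Zkj.
  by rewrite -(inj_eq enum_val_inj) Dk Dj; apply/eqP/rcoset_eqP; rewrite
    mem_rcoset.
by rewrite -[LHS](eqP fullM) (eqP freeM).
Qed.

Local Notation psi := (sdprod_Iirr defG i).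

Let psiE v h : v \in V -> h \in H -> 'chi_psi (v * h)%g = 'chi_i h.
Proof. by move=> Vv Hh; rewrite sdprod_IirrE cfSdprodE. Qed.

Let psi1 : 'chi_psi 1%g = 'chi_i 1%g.
Proof. by rewrite sdprod_IirrE cfSdprod1. Qed.

(** Write x = v * h. For h in Z(H), all conjugates of x act as red (lam h). Otherwise psi x = 0, and
    the class sum acts as a scalar of trace 0, which is 0 because n is nonzero in F. *)
Lemma repr_central_charE : repr_affords_central_char rG
  (fun K => red 'omega_psi[gset_mx algC G K]).
Proof.
move=> K clK; rewrite -[K in LHS](enum_rankK_in clK clK) -[K in
  RHS](enum_rankK_in clK clK).
set k := enum_rank_in _ _; have [x Gx Dk] := imsetP (enum_valP k).
rewrite (@gring_mode_class_sum_eq _ _ _ _ x) Dk ?class_refl // raddf_sum /=.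
rewrite (eq_bigr (fun y => rG y)) => [|y xGy]; last first.
  by rewrite gring_opG // (subsetP (class_subG Gx (subxx G))).
have [v [h [Vv Hh Dx]]] := sdprodP Gx.
rewrite {3}Dx psiE // psi1.
have [Zh | notZh] := boolP (h \in 'Z(H)).
  rewrite chiE // ['chi_i _ * _]mulrC mulrA mulfK ?irr1_neq0 //.
  have Alam : lam h \in Aint := Aint_char h (lin_charW lam_lin).
  rewrite (redM redP) ?rpred_nat // (red_nat redP).
  rewrite (eq_bigr (fun=> (red (lam h))%:M)) => [|_ /imsetP[g Gg ->]].
    by rewrite sumr_const -scaler_nat scale_scalar_mx.
  rewrite repr_conj // Dx repr_sdprodE // (rGZ Zh) scalar_mxC -mulmxA.
  by rewrite -repr_mxM ?groupV // mulVg repr_mx1 mulmx1.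
rewrite (central_type_vanish chi1 notZh) mulr0 mul0r (red0 redP).
set S := \sum_(y in _) _.
have /is_scalar_mxP[c DS]: is_scalar_mx S.
  apply: (mx_abs_irr_cent_scalar absG); apply/centgmxP=> g Gg.
  rewrite mulmx_suml mulmx_sumr [RHS](reindex_inj (conjg_inj g)) /=.
  apply: eq_big => y; first by rewrite memJ_norm // (subsetP (class_norm x G)).
  move=> xGy; have Gy := subsetP (class_subG Gx (subxx G)) y xGy.
  by rewrite -!repr_mxM ?groupJ // conjgC.
rewrite DS; congr _%:M; apply: (mulIf repr_degree_neq0); rewrite mul0r.
rewrite mulr_natr -mxtrace_scalar -DS raddf_sum big1 //= => _ /imsetP[g Gg ->].
rewrite repr_conj // mxtrace_mulC mulmxA -repr_mxM ?groupV // mulgV repr_mx1.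
by rewrite mul1mx Dx repr_sdprodE // repr_trace0.
Qed.

(** For h in Z(H), all n lifts equal lam h by injectivity of [red]. Otherwise multiplication by c !=
    1 permutes s, so its sum is 0. As V acts trivially, x may be any element of G. *)
Lemma Brauer_lift_sum x (s : seq algC) : x \in G ->
    (forall z, z \in s -> pprime_unity_root p z) ->
    char_poly (rG x) = \prod_(z <- s) ('X - (red z)%:P) ->
  \sum_(z <- s) z = 'chi_psi x.
Proof.
move=> Gx us; have [v [h [Vv Hh ->]]] := sdprodP Gx.
rewrite repr_sdprodE // psiE // => Ds.
have size_s : size s = n.
  by apply: succn_inj; rewrite -(size_prod_XsubC s red) -Ds size_char_poly.
rewrite -(big_map red xpredT (fun y => 'X - y%:P)) in Ds.
have [Zh | notZh] := boolP (h \in 'Z(H)).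
  have Ms : perm_eq (map red s) (map red (nseq n (lam h))).
    apply: prod_XsubC_eq; rewrite -Ds rGZ // map_nseq big_nseq.
    rewrite char_poly_trig ?scalar_mx_is_trig //.
    rewrite (eq_bigr (fun=> 'X - (red (lam h))%:P)) => [|k _]; last by rewrite
      mxE eqxx.
    by rewrite big_const_ord.
  have {}Ms := perm_unity_roots redP pr_p us _ Ms.
  rewrite (perm_big _ (Ms _)) /= => [|z].
    by rewrite big_nseq iter_addr_0 chiE // -repr_degree mulr_natl.
  by rewrite mem_nseq => /andP[_ /eqP->]; apply: central_lin_char_unity_root.
rewrite (central_type_vanish chi1 notZh).
have [c [g Hg [uc c_neq1 Dhg]]] := repr_conj_scale Hh notZh.
have [Gh Gg] := (subsetP sHG h Hh, subsetP sHG g Hg).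
have red_c : red c != 0.
  have Ac := pprime_unity_root_Aint uc; have [m pm c1] := uc.
  have m_gt0 : (0 < m)%N by case: m pm {c1}; rewrite ?dvdn0.
  apply: contra_eq_neq (red1 redP) => c0.
  by rewrite -c1 (redX redP) // c0 expr0n gtn_eqF // eq_sym oner_neq0.
have ucs z : z \in map ( *%R c) s -> pprime_unity_root p z.
  by case/mapP=> y /us uy ->; apply: pprime_unity_rootM.
have Ms : perm_eq s (map ( *%R c) s).
  apply: (perm_unity_roots redP) => //; apply: prod_XsubC_eq.
  rewrite -Ds; have -> : char_poly (rG h) = char_poly (red c *: rG h).
    by rewrite -Dhg repr_conj // char_poly_conj // -repr_mxM ?groupV // mulVg
      repr_mx1.
  rewrite (char_poly_scale red_c Ds) !big_map; apply: eq_big_seq => z /us uz.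
  by rewrite (redM redP) // (pprime_unity_root_Aint uc, pprime_unity_root_Aint
    uz).
apply/eqP; move: (perm_big _ Ms : \sum_(z <- s) z = _) => /eqP.
rewrite big_map -mulr_sumr -subr_eq0 -{1}[\sum_(_ <- _) _]mul1r -mulrBl
  mulf_eq0.
by rewrite subr_eq0 eq_sym (negPf c_neq1).
Qed.

Lemma Brauer_lift_exists x : x \in G -> exists2 s : seq algC,
    forall z, z \in s -> pprime_unity_root p z
  & char_poly (rG x) = \prod_(z <- s) ('X - (red z)%:P).
Proof.
move=> Gx; have [v [h [Vv Hh ->]]] := sdprodP Gx; rewrite repr_sdprodE //.
have [t Dt] := closed_field_poly_normal (char_poly (rG h)).
rewrite (monicP (char_poly_monic _)) scale1r in Dt.
(* The eigenvalues of rG h are #|H|-th roots of unity, and p does not divide #|H|. *)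
have [y ty | s us Ds] := lift_unity_roots redP (p'group_ndvdn (dvdnn _)) (t :=
  t).
  have: root (char_poly (rG h)) y by rewrite Dt root_prod_XsubC.
  rewrite -eigenvalue_root_char => /eigenvalueP[u Du nz_u].
  have uX k : u *m rG (h ^+ k)%g = y ^+ k *: u.
    elim: k => [|k IHk]; first by rewrite expg0 repr_mx1 mulmx1 scale1r.
    rewrite expgS exprSr repr_mxM ?groupX ?(subsetP sHG h) // mulmxA Du.
    by rewrite -scalemxAl IHk scalerA mulrC.
  have /eqP := uX #|H|; rewrite expg_cardG // repr_mx1 mulmx1 eq_sym.
  rewrite -subr_eq0 -{2}[u]scale1r -scalerBl scaler_eq0 (negPf nz_u) orbF.
  by rewrite subr_eq0 => /eqP.
by exists s => //; rewrite Dt -Ds big_map.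
Qed.

End Representation.

(** E is, up to the factor |Z(H)|, the idempotent of red o lam in F Z(H). It is central in FG, so
    its row space is a submodule of the regular module on which Z(H) acts through red o lam; any
    simple submodule will do. *)
Lemma irr_repr_exists : exists n (rG : mx_representation F G n),
  mx_irreducible rG /\ {in 'Z(H), forall z, rG z = (red (lam z))%:M}.
Proof.
pose aG := regular_repr F G.
pose E := \sum_(z in 'Z(H)) red (lam z^-1%g) *: aG z.
have Alam z : lam z \in Aint := Aint_char z (lin_charW lam_lin).
have EZ z : z \in 'Z(H) -> E *m aG z = red (lam z) *: E.
  move=> Zz; rewrite mulmx_suml scaler_sumr [RHS](reindex_acts 'R _ Zz)
    ?astabsR //=.
  apply: eq_bigr => y Zy; rewrite -scalemxAl -repr_mxM ?(subsetP sZG) //.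
  rewrite invMg lin_charM ?groupV // scalerA -(redM redP) ?rpredM //.
  by rewrite (lin_charV lam_lin Zz) mulVKf ?lin_char_neq0.
have modE : mxmodule aG E.
  apply/mxmoduleP=> x Gx; suffices -> : E *m aG x = aG x *m E by apply: submxMl.
  rewrite mulmx_suml mulmx_sumr; apply: eq_bigr => z Zz.
  have Gz := subsetP sZG z Zz; rewrite -scalemxAl -scalemxAr -!repr_mxM //.
  by have /setIP[_ /centP->] := subsetP sZGcenter z Zz.
have nzE : E != 0.
  apply: contraTneq (oner_neq0 F) => E0; apply/negPn/eqP.
  (* The coefficient of the identity of G in E is red (lam 1) = 1. *)
  have <- : gring_row E 0 (gring_index G 1%g) = 0 by rewrite E0 linear0 mxE.
  rewrite linear_sum summxE (bigD1 1%g) ?group1 //=.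
  rewrite big1 => [|y /andP[Zy nz_y]]; rewrite linearZ !mxE /=; last first.
    rewrite gring_indexK ?group1 // mul1g (can_in_eq (@gring_indexK _ G))
      ?(subsetP sZG y) //.
    by rewrite eq_sym (negPf nz_y) mulr0.
  rewrite invg1 lin_char1 // (red1 redP) gring_indexK ?group1 // mulg1 eqxx.
  by rewrite !mulr1 addr0.
have [M simM sME] := dec_mxsimple_exists modE nzE.
have [modM _ _] := simM; exists (\rank M), (submod_repr modM); split.
  exact/submod_mx_irr.
move=> z Zz; rewrite /= /submod_mx.
suffices -> : val_submod 1%:M *m aG z = red (lam z) *: (val_submod 1%:M :
  'M_(\rank M, _)).
  by rewrite linearZ /= val_submodK scale_scalar_mx mulr1.
have /submxP[D ->] : (val_submod (1%:M : 'M_(\rank M)) <= E)%MS.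
  exact: submx_trans (val_submodP _) sME.
by rewrite -mulmxA EZ // scalemxAr.
Qed.

Lemma IBr_central_char_inflation (phi : 'CF(G)) :
    phi \in 'CF(G, p_regular p G) ->
    {in p_regular p G, 'chi_(sdprod_Iirr defG i) =1 phi} ->
  forall theta : 'CF(G),
    IBr_central_char p red theta
      (fun K => red 'omega_(sdprod_Iirr defG i)[gset_mx algC G K])
    <-> theta = phi.
Proof.
move=> phi_reg Dphi theta.
split=> [[n [rG [irrG [theta_reg theta_s] cenG]]] | ->].
  have rGZ : {in 'Z(H), forall z, rG z = (red (lam z))%:M}.
    move=> z Zz; have Gz := subsetP sZG z Zz.
    (* The class of z is a singleton, so the central character at this class is the scalar by which
       z acts. *)
    have clz : z ^: G = [set z].
      by apply/cent_classP; have /setIP[] := subsetP sZGcenter z Zz.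
    have -> : rG z = gring_op rG (gset_mx F G (z ^: G)).
      by rewrite /gset_mx clz big_set1 gring_opG.
    rewrite (cenG _ (mem_classes Gz)); congr (red _)%:M.
    have -> : gset_mx algC G (z ^: G) = regular_repr algC G z.
      by rewrite /gset_mx clz big_set1.
    rewrite xcfunG // unlock cfunE. 
    rewrite sdprod_IirrE (cfSdprodEr defG 'chi_i (subsetP sZH z Zz)) (chiE Zz).
    by rewrite cfSdprod1 (mulKf (irr1_neq0 i)).
  apply/cfunP=> x; have [reg_x | nreg_x] := boolP (x \in p_regular p G); last
    first.
    by rewrite !(cfun_on0 _ nreg_x).
  have Gx : x \in G by case/setIdP: reg_x.
  have [s [us Ds ->]] := theta_s x reg_x.
  by rewrite (Brauer_lift_sum irrG rGZ Gx us Ds) Dphi.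
have [n [rG [irrG rGZ]]] := irr_repr_exists.
exists n, rG; split=> //; last exact: repr_central_charE.
split=> // x reg_x; have Gx : x \in G by case/setIdP: reg_x.
have [s us Ds] := Brauer_lift_exists irrG Gx.
by exists s; split=> //; rewrite (Brauer_lift_sum irrG rGZ Gx us Ds) Dphi.
Qed.

End Block.

(** * Uniqueness of the lift *)

(** If C_V(B) = 1, coprime action gives V = [V, B], which lies in the kernel of the B-invariant
    mu. *)
Lemma coprime_fixed_lin_char (gT : finGroupType) (V B : {group gT})
    (mu : 'CF(V)) :
    B \subset 'N(V) -> coprime #|V| #|B| -> abelian V ->
    mu \is a linear_char -> mu != 1 -> B \subset 'I[mu] ->
  'C_V(B) != 1%g.
Proof.
move=> nVB coVB cVV lin_mu mu_neq1 fix_mu; apply: contraNneq mu_neq1 => CVB1.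
have sKV : [~: V, B] \subset V by rewrite commg_subl.
have nKB : B \subset 'N([~: V, B]) by rewrite commg_normr.
have sVK : V \subset [~: V, B].
  (* B centralizes V / [V, B], which by coprimeness is the image of C_V(B) = 1. *)
  rewrite -quotient_sub1 ?commg_norml // -(quotient1 [~: V, B]) -CVB1.
  rewrite coprime_quotient_cent ?abelian_sol // subsetI subxx /=.
  exact: quotient_cents2r.
have sVker : V \subset cfker mu.
  apply: subset_trans sVK _; rewrite gen_subG; apply/subsetP=> _ /imset2P[x b
    Vx Bb ->].
  have Vxb : (x ^ b)%g \in V by rewrite memJ_norm // (subsetP nVB).
  rewrite /= (cfkerEchar (lin_charW lin_mu)) inE groupM ?groupV //=.
  rewrite lin_charM ?groupV // lin_charV // (inertia_valJ _ (subsetP fix_mu b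
    Bb)).
  by rewrite mulVf ?lin_char_neq0 ?lin_char1.
apply/eqP/cfun_inP=> x Vx; rewrite cfun1E Vx.
by rewrite cfker1 ?lin_char1 // (subsetP sVker).
Qed.

Section UniqueLift.

Variables (p : nat) (gT : finGroupType) (G V H : {group gT}).
Hypotheses (defG : V ><| H = G) (pV : p.-group V) (p'H : p^'.-group H).
Hypotheses (cVV : abelian V) (cVZ : 'Z(H) \subset 'C(V)).
Hypothesis large_orbits : forall v, v \in V^# ->
  (#|'C_H[v] : 'Z(H)| < #|H : 'C_H[v]|)%N.

Variable i : Iirr H.
Hypothesis chi1 : 'chi_i 1%g ^+ 2 = #|H : 'Z(H)|%:R.

Lemma sub_cfker_lift (j : Iirr G) :
  {in H, 'chi_j =1 'chi_i} -> V \subset cfker 'chi_j.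
Proof.
move=> eq_ji; have [nsVG sHG _ nVH _] := sdprod_context defG.
have sVG := normal_sub nsVG.
have [k chi_k] : {k | k \in irr_constt ('Res[V] 'chi_j)}.
  by apply/sigW/neq0_has_constt; rewrite Res_irr_neq0.
have [k0 | k_neq0] := eqVneq k 0.
  by apply: constt0_Res_cfker; rewrite // -k0.
have lin_k : 'chi_k \is a linear_char by apply/char_abelianP.
pose B := (H :&: 'I_G['chi_k])%G.
have sBH : B \subset H := subsetIl _ _.
have [v CVBv v_neq1] : exists2 v, v \in 'C_V(B) & v != 1%g.
  apply/trivgPn; apply: (@coprime_fixed_lin_char _ _ _ 'chi_k) => //.
  - exact: subset_trans sBH nVH.
  - exact: pnat_coprime pV (pgroupS sBH p'H).
  - by rewrite irr_eq1.
  - by rewrite /= subIset // subsetIr orbT.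
have [Vv cBv] := setIP CVBv.
have sBC : B \subset 'C_H[v] by rewrite subsetI sBH sub_cent1.
have sZC : 'Z(H) \subset 'C_H[v].
  by rewrite subsetI center_sub sub_cent1 (subsetP _ v Vv) // centsC.
have lt_v : (#|'C_H[v] : 'Z(H)| < #|H : 'C_H[v]|)%N.
  by apply: large_orbits; rewrite !inE v_neq1.
have le_HG : (#|H : B| <= #|G : 'I_G['chi_k]|)%N.
  by rewrite indexgI subset_leq_card ?imsetS.
(* By Clifford, the restriction to V is a positive multiple of the sum of the G-orbit of ['chi_k],
   all of whose members have degree 1. *)
have le_orbit : #|G : 'I_G['chi_k]|%:R <= 'chi_j 1%g.
  rewrite -(cfResE _ sVG) // (Clifford_Res_sum_cfclass nsVG chi_k) cfunE
    sum_cfunE.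
  have [m Dm] : exists m, '['Res[V] 'chi_j, 'chi_k] = m%:R.
    by apply/natrP; rewrite Cnat_cfdot_char ?cfRes_char ?irr_char.
  move: chi_k; rewrite irr_consttE Dm pnatr_eq0 -lt0n => m_gt0.
  rewrite (eq_big_seq (fun=> 1)) => [|_ /cfclassP[y Gy ->]].
    rewrite big_const_seq count_predT iter_addr_0 size_cfclass.
    by rewrite ler_peMl ?ler0n // ler1n.
  by rewrite cfConjg1 lin_char1.
(* |H : Z(H)| = |H : C_H(v)| |C_H(v) : Z(H)| < |H : C_H(v)|^2 <= chi(1)^2 = |H : Z(H)|. *)
have : (#|H : 'Z(H)| < #|H : 'Z(H)|)%N; last by rewrite ltnn.
rewrite -{1}(Lagrange_index (subsetIl H 'C[v]) sZC) -(ltr_nat algC) -chi1.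
have le_d : #|H : 'C_H[v]|%:R <= 'chi_i 1%g.
  rewrite -eq_ji //; apply: le_trans le_orbit; rewrite ler_nat.
  by apply: leq_trans le_HG; rewrite dvdn_leq ?indexg_gt0 ?indexgS.
apply: lt_le_trans (_ : #|H : 'C_H[v]|%:R ^+ 2 <= _); last first.
  by rewrite lerXn2r ?nnegrE ?ler0n // ltW ?irr1_gt0.
by rewrite -natrX ltr_nat ltn_pmul2l ?indexg_gt0.
Qed.

(** H consists of p-regular elements, so a lift agrees with chi on H; once V is in its kernel, it is
    the inflation of its restriction to H. *)
Lemma unique_lift (j : Iirr G) :
    {in p_regular p G, 'chi_j =1 'chi_(sdprod_Iirr defG i)} ->
  j = sdprod_Iirr defG i.
Proof.
move=> eq_j; have [_ sHG _ _ _] := sdprod_context defG.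
have eq_ji : {in H, 'chi_j =1 'chi_i}.
  move=> h Hh; rewrite eq_j ?sdprod_IirrE ?cfSdprodEr //.
  by rewrite inE (subsetP sHG) // (mem_p_elt p'H).
apply: irr_inj; rewrite sdprod_IirrE -(cfRes_sdprodK defG (sub_cfker_lift
  eq_ji)).
by congr cfSdprod; apply/cfun_inP=> h Hh; rewrite cfResE ?eq_ji.
Qed.

End UniqueLift.

(** * The block, for internal and external semidirect products *)

Lemma sdprod_block_unique_lift (p : nat) (F : fieldType) (red : algC -> F)
    (gT : finGroupType) (G V H : {group gT}) :
  prime p -> modular_reduction p red ->
  V ><| H = G -> p.-group V -> p^'.-group H -> abelian V ->
  'Z(H) \subset 'C(V) -> central_type H ->
  (forall v, v \in V^# -> (#|'C_H[v] : 'Z(H)| < #|H : 'C_H[v]|)%N) ->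
  exists (B : p_block p red G) (phi : 'CF(G)),
    (forall psi : 'CF(G), in_IBr_block B psi <-> psi = phi) /\
    (exists! chi : Iirr G, is_lift B phi chi).
Proof.
move=> pr_p redP defG pV p'H cVV cVZ [i chi1] large_orbits.
have [Fc DF] := closedFieldType_exists (red_closed_field redP).
(* From here on F is the underlying field of a [closedFieldType], as the results on modules
   require. *)
case: F / DF red redP => red redP.
have [lam lin_lam chiE] := central_type_lin_char chi1.
pose psi := sdprod_Iirr defG i.
pose B := @PBlock p Fc red gT G _ (or_introl (ex_intro
  (fun j => irr_affords_central_char red j
     (fun K => red 'omega_psi[gset_mx algC G K])) psi (fun K _ => erefl))).
have reg_normal : p_regular p G <| G.
  apply/andP; split; first by apply/subsetP=> x /setIdP[].
  apply/subsetP=> g Gg; rewrite inE; apply/subsetP=> _ /imsetP[x /setIdP[Gx px]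
    ->].
  by rewrite inE groupJ // p_eltJ.
(* Brauer characters are extended by 0, so psi is cut off outside the p-regular elements. *)
pose phi := 'chi_psi * '1_(p_regular p G).
have phiE : {in p_regular p G, 'chi_psi =1 phi}.
  by move=> x reg_x; rewrite /phi cfunE cfuniE // reg_x mulr1.
have phi_reg : phi \in 'CF(G, p_regular p G).
  by apply/cfun_onP=> x nreg_x; rewrite /phi cfunE cfuniE // (negPf nreg_x)
    mulr0.
exists B, phi; split=> [theta|].
  exact: (IBr_central_char_inflation pr_p redP pV p'H cVZ chi1 lin_lam chiE
    phi_reg phiE).
exists psi; split=> [|j [_ eq_j]]; first by split.
apply/esym/(unique_lift pV p'H cVV cVZ large_orbits chi1) => x reg_x.
by rewrite eq_j // phiE.
Qed.

Theorem theorem8 (p : nat) (F : fieldType) (red : algC -> F)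
    (aT rT : finGroupType) (H : {group aT}) (V : {group rT})
    (to : groupAction H V) :
  prime p ->
  modular_reduction p red ->
  p^'.-group H ->
  central_type H ->
  p.-abelem V ->
  'Z(H) \subset 'C(V | to) ->
  [faithful H / 'Z(H), on V | to %% 'Z(H)] ->
  (forall v, v \in V^# ->
     (#|H : 'C_H[v | to]| > #|'C_H[v | to] : 'Z(H)|)%N) ->
  let G := [set: sdprod_by to]%G in
  exists (B : p_block p red G) (phi : 'CF(G)),
    (forall psi : 'CF(G), in_IBr_block B psi <-> psi = phi) /\
    (exists! chi : Iirr G, is_lift B phi chi).
Proof.
move=> pr_p redP p'H [i chi1] abV cVZ _ large_orbits G.
have [injV injH] := (injm_sdpair1 to, injm_sdpair2 to).
have [pV cVV _] := and3P abV.
have ZE : 'Z(sdpair2 to @* H) = sdpair2 to @* 'Z(H) by rewrite injm_center.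
apply: (@sdprod_block_unique_lift p F red _ G (sdpair1 to @* V) (sdpair2 to @*
  H)) => //.
- exact: sdprod_sdpair.
- exact: morphim_pgroup.
- exact: morphim_pgroup.
- exact: morphim_abelian.
- by rewrite /= ZE sub_morphim_pre ?center_sub // -astabEsd.
- have isoH : isom H (sdpair2 to @* H) (sdpair2 to) by apply/isomP.
  exists (isom_Iirr isoH i).
  by rewrite isom_IirrE cfIsom1 chi1 /= ZE index_injm ?center_sub.
move=> w /setD1P[w_neq1 /morphimP[v _ Vv Dw]].
have v_neq1 : v != 1%g by apply: contraNneq w_neq1 => v1; rewrite Dw v1 morph1.
(* Inside the semidirect product the action is conjugation, so stabilizers become centralizers. *)
have CE : 'C_(sdpair2 to @* H)[sdpair1 to v] = sdpair2 to @* 'C_H[v | to].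
  rewrite astabEsd ?sub1set // morphim_set1 // morphim_setIpre; congr (_ :&: _).
  by rewrite cent_set1.
rewrite Dw /= CE ZE !index_injm ?subsetIl //.
by apply: large_orbits; rewrite !inE v_neq1.
Qed.
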